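(* Let $X$ and $Y$ be infinite-dimensional homogeneous Hilbertian operator spaces. If there is a Lipschitz map $f\colon B_X\to Y$ which is completely almost uncollapsed, then $\kappa_n(X)\lesssim\kappa_n(Y)$.
   Context: Operator spaces are complex: an operator space is a closed linear subspace $X\subseteq \mathcal B(H)$, $H$ a complex Hilbert space, with $\mathrm M_n(X)$ normed through $\mathrm M_n(X)\subseteq \mathrm M_n(\mathcal B(H))\cong\mathcal B(H^{\oplus n})$. $B_E$ is the closed unit ball of $E$. For a map $f$, $f_n([x_{ij}])=[f(x_{ij})]$; for linear $u$, $\|u\|_{\rm cb}=\sup_n\|u_n\|$. An operator space $X$ is Hilbertian if it is linearly isometric to a Hilbert space, and homogeneous if $\|u\|_{\rm cb}=\|u\|$ for every bounded linear $u\colon X\to X$. For a homogeneous Hilbertian operator space $X$ with $\dim X\ge n$, $\kappa_n(X)$ is the norm in $\mathrm M_n(X)$ of the matrix whose first column is $(e_1,\dots,e_n)^T$ and whose other entries are $0$, where $\{e_1,\dots,e_n\}$ is any orthonormal set in $X$ (the value does not depend on the choice). A map $f\colon B_X\to Y$ is completely almost uncollapsed if there are $t\in(0,1)$ and $\varepsilon>0$ such that, for all $n\in\mathbb N$ and all $x,z\in B_{\mathrm M_n(X)}$, $\|x-z\|_{\mathrm M_n(X)}=t$ implies $\|f_n(x)-f_n(z)\|_{\mathrm M_n(Y)}\ge\varepsilon$. Lipschitz is meant in the usual sense for the norms of $X$ and $Y$. For positive sequences, $a_n\lesssim b_n$ means there is a constant $K>0$ with $a_n\le Kb_n$ for all $n\in\mathbb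 N$. *)

(* Defs.v *)
From HB Require Import structures.
From mathcomp Require Import all_boot all_order all_algebra.
From mathcomp Require Import sesquilinear complex.
From mathcomp Require Import all_classical all_reals all_analysis.
Set Implicit Arguments.
Unset Strict Implicit.
Unset Printing Implicit Defensive.
Import Order.TTheory GRing.Theory Num.Theory.
Import numFieldNormedType.Exports.
Local Open Scope classical_set_scope.
Local Open Scope ring_scope.
Local Open Scope complex_scope.

(* The norm of a normedModType R[i] is R[i]-valued; [rnorm] is the same norm as
   a real number. *)
Definition rnorm (R : realType) (V : normedModType R[i]) (x : V) : R :=
  complex.Re `|x|.

(* [hs_dot] is linear in its first argument. *)
Record hilbertSpace (R : realType) := HilbertSpace {
  hs_sort :> completeNormedModType R[i];
  hs_dot : {dot hs_sort for @Num.conj R[i]};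
  hs_normE : forall x : hs_sort, `|x| ^+ 2 = hs_dot x x }.

(* Operator norm, in [0, +oo], of a map between sets carrying the real-valued
   norms N and N'. *)
Definition eopnorm (R : realType) (V W : Type) (N : V -> R) (N' : W -> R)
    (f : V -> W) : \bar R :=
  ereal_sup [set (N' (f v))%:E | v in [set v | N v <= 1]].

Definition bounded_op (R : realType) (H : hilbertSpace R) : {pred (H -> H)} :=
  fun f => `[< linear f /\ (eopnorm (@rnorm R H) (@rnorm R H) f < +oo)%E >].

Record bop (R : realType) (H : hilbertSpace R) := Bop {
  bop_fun :> H -> H;
  bop_funP : bop_fun \in @bounded_op R H }.

Section rnorm_theory.
Context (R : realType) (V : normedModType R[i]).
Implicit Types x y : V.

Lemma rnormE x : `|x| = (rnorm x)%:C.
Proof. by rewrite /rnorm RRe_real// ger0_real. Qed.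

Lemma rnorm_ge0 x : 0 <= rnorm x.
Proof. by have := normr_ge0 x; rewrite rnormE ler0c. Qed.

Lemma rnorm0 : rnorm (0 : V) = 0.
Proof. by rewrite /rnorm normr0. Qed.

Lemma rnorm_eq0 x : rnorm x = 0 -> x = 0.
Proof. by move=> x0; apply/normr0_eq0; rewrite rnormE x0. Qed.

Lemma rnormD x y : rnorm (x + y) <= rnorm x + rnorm y.
Proof. by have := ler_normD x y; rewrite !rnormE -rmorphD lecR. Qed.

Lemma rnormZ (a : R[i]) x : rnorm (a *: x) = complex.Re `|a| * rnorm x.
Proof.
rewrite {1}/rnorm normrZ rnormE -[X in X * _]RRe_real ?ger0_real//.
by rewrite -rmorphM.
Qed.

End rnorm_theory.

Section bop_theory.
Context (R : realType) (H : hilbertSpace R).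
Local Notation opn := (eopnorm (@rnorm R H) (@rnorm R H)).

Lemma eopnorm_ge0 (f : H -> H) : (0 <= opn f)%E.
Proof.
apply: (@le_trans _ _ (rnorm (f 0))%:E); first by rewrite lee_fin rnorm_ge0.
by apply: ereal_sup_ubound; exists 0 => //=; rewrite rnorm0 ler01.
Qed.

Lemma eopnorm_leP (f : H -> H) (M : R) :
  (opn f <= M%:E)%E <-> forall v, rnorm v <= 1 -> rnorm (f v) <= M.
Proof.
split=> [fM v v1|fM].
  rewrite -lee_fin; apply: le_trans fM.
  by apply: ereal_sup_ubound; exists v.
by apply: ge_ereal_sup => _ [v v1 <-]; rewrite lee_fin fM.
Qed.

Lemma bounded_op_submod : submod_closed (@bounded_op R H).
Proof.
have bd f : (opn f < +oo)%E ->
    exists M : R, forall v, rnorm v <= 1 -> rnorm (f v) <= M.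
  move=> foo; exists (fine (opn f)); apply/eopnorm_leP.
  by rewrite fineK// ge0_fin_numE// eopnorm_ge0.
have ltoo f (M : R) : (forall v, rnorm v <= 1 -> rnorm (f v) <= M) ->
    (opn f < +oo)%E.
  by move/eopnorm_leP => fM; apply: le_lt_trans fM _; rewrite ltry.
split.
  apply/asboolP; split; first by move=> a u v /=; rewrite scaler0 addr0.
  by apply: (ltoo _ 0) => v _; rewrite rnorm0.
move=> a f g /asboolP[lf /bd[M fM]] /asboolP[lg /bd[N gN]].
apply/asboolP; split.
  move=> b u v.
  change (a *: f (b *: u + v) + g (b *: u + v) =
          b *: (a *: f u + g u) + (a *: f v + g v)).
  by rewrite lf lg !scalerDr !scalerA (mulrC a b) addrACA.
apply: (ltoo _ (complex.Re `|a| * M + N)) => v v1.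
apply: (le_trans (rnormD _ _)).
rewrite lerD ?gN// rnormZ ler_wpM2l ?fM//.
exact: (@rnorm_ge0 R R[i]^o a).
Qed.

HB.instance Definition _ :=
  GRing.isSubmodClosed.Build _ _ (@bounded_op R H) bounded_op_submod.
HB.instance Definition _ := [isSub for @bop_fun R H].
HB.instance Definition _ := [Choice of bop H by <:].
HB.instance Definition _ := [SubChoice_isSubLmodule of bop H by <:].

Definition bop_norm (f : bop H) : R[i] := (fine (opn f))%:C.

Lemma bop_linear (f : bop H) : linear f.
Proof. by have /asboolP[] := bop_funP f. Qed.

HB.instance Definition _ (f : bop H) :=
  GRing.isLinear.Build R[i] H H *:%R (bop_fun f) (bop_linear f).

Lemma bop_norm_ub (f : bop H) v :
  rnorm v <= 1 -> rnorm (f v) <= fine (opn f).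
Proof.
move: v; apply/eopnorm_leP; have /asboolP[_ foo] := bop_funP f.
by rewrite fineK// ge0_fin_numE// eopnorm_ge0.
Qed.

Lemma bop_norm_le (f : bop H) (M : R) :
  (forall v, rnorm v <= 1 -> rnorm (f v) <= M) -> fine (opn f) <= M.
Proof.
move/eopnorm_leP => fM; rewrite -lee_fin fineK// ge0_fin_numE ?eopnorm_ge0//.
by have /asboolP[_] := bop_funP f.
Qed.

Lemma bop_norm_ge0 (f : bop H) : 0 <= fine (opn f).
Proof. by rewrite fine_ge0// eopnorm_ge0. Qed.

Lemma bop_normD (f g : bop H) : bop_norm (f + g) <= bop_norm f + bop_norm g.
Proof.
rewrite /bop_norm -rmorphD lecR; apply: bop_norm_le => v v1.
by rewrite (le_trans (rnormD (f v) (g v)))// lerD// bop_norm_ub.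
Qed.

Lemma bop_normZ_le (a : R[i]) (f : bop H) :
  fine (opn (a *: f)) <= complex.Re `|a| * fine (opn f).
Proof.
apply: bop_norm_le => v v1.
rewrite [leLHS](rnormZ a (f v)) ler_wpM2l ?bop_norm_ub//.
exact: (@rnorm_ge0 R R[i]^o a).
Qed.

Lemma bop_normZ (a : R[i]) (f : bop H) :
  bop_norm (a *: f) = `|a| * bop_norm f.
Proof.
rewrite (@rnormE R R[i]^o a) /bop_norm -rmorphM; congr (_%:C).
apply/le_anti/andP; split; first exact: bop_normZ_le.
have [->|a0] := eqVneq a 0; first by rewrite (@rnorm0 R R[i]^o) mul0r bop_norm_ge0.
have a_gt0 : 0 < @rnorm R R[i]^o a.
  by rewrite lt_neqAle rnorm_ge0 andbT eq_sym; apply: contra_neq a0 => /rnorm_eq0.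
rewrite -ler_pdivlMl//.
have := bop_normZ_le a^-1 (a *: f); rewrite scalerA mulVf// scale1r.
move=> /le_trans; apply; rewrite ler_wpM2r ?bop_norm_ge0//.
by rewrite normfV (@rnormE R R[i]^o a) -(fmorphV (real_complex R)).
Qed.

Lemma bop_norm_eq0 (f : bop H) : bop_norm f = 0 -> f = 0.
Proof.
move=> /complexI f0; apply/val_inj/funext => v.
change (f v = 0); apply: rnorm_eq0.
have [->|v0] := eqVneq v 0; first by rewrite linear0 rnorm0.
have v_gt0 : 0 < rnorm v.
  rewrite lt_neqAle rnorm_ge0 andbT eq_sym.
  by apply: contra_neq v0 => /rnorm_eq0.
pose w := (rnorm v)^-1%:C *: v.
have rcE (r : R) : 0 <= r -> complex.Re `|r%:C| = r.
  by move=> r0; rewrite ger0_norm ?ler0c.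
have w1 : rnorm w <= 1.
  by rewrite rnormZ rcE ?invr_ge0 ?rnorm_ge0// mulVf// gt_eqF.
have := bop_norm_ub f w1.
rewrite f0 linearZ rnormZ rcE ?invr_ge0 ?rnorm_ge0//.
rewrite pmulr_rle0 ?invr_gt0// => fv.
by apply/le_anti; rewrite fv rnorm_ge0.
Qed.

HB.instance Definition _ := Lmodule_isNormed.Build R[i] (bop H)
  bop_normD bop_normZ bop_norm_eq0.

End bop_theory.

Record opSpace (R : realType) := OpSpace {
  os_hilb : hilbertSpace R;
  os_set : set (bop os_hilb);
  os_submod : submod_closed (mem os_set);
  os_closed : closed os_set }.

Arguments os_set {R} X _ : rename.

Definition os_mem (R : realType) (X : opSpace R) : {pred bop (os_hilb X)} :=
  mem (os_set X).
Arguments os_mem {R} X _ : rename.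

Record os_type (R : realType) (X : opSpace R) := OsElt {
  os_op : bop (os_hilb X);
  os_opP : os_op \in os_mem X }.
Coercion os_type : opSpace >-> Sortclass.

Section os_type_theory.
Context (R : realType) (X : opSpace R).

HB.instance Definition _ :=
  GRing.isSubmodClosed.Build _ _ (os_mem X) (os_submod X).
HB.instance Definition _ := [isSub for @os_op R X].
HB.instance Definition _ := [Choice of os_type X by <:].
HB.instance Definition _ := [SubChoice_isSubLmodule of os_type X by <:].

Lemma os_normD (x y : X) : `|os_op (x + y)| <= `|os_op x| + `|os_op y|.
Proof. exact: ler_normD. Qed.

Lemma os_normZ (a : R[i]) (x : X) : `|os_op (a *: x)| = `|a| * `|os_op x|.
Proof. exact: normrZ. Qed.

Lemma os_norm_eq0 (x : X) : `|os_op x| = 0 -> x = 0.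
Proof. by move/normr0_eq0 => x0; exact/val_inj. Qed.

HB.instance Definition _ := Lmodule_isNormed.Build R[i] (os_type X)
  os_normD os_normZ os_norm_eq0.

End os_type_theory.

Section matrices.
Context (R : realType).

(* Norm of the Hilbert direct sum of n copies of H. *)
Definition l2norm (H : hilbertSpace R) n (v : 'I_n -> H) : R :=
  Num.sqrt (\sum_i rnorm (v i) ^+ 2).

(* The operator on the direct sum of n copies of H given by a matrix over
   X, under the identification of M_n(B(H)) with B(H^n). *)
Definition mx_op (X : opSpace R) n (x : 'M[X]_n)
    (v : 'I_n -> os_hilb X) : 'I_n -> os_hilb X :=
  fun i => \sum_j os_op (x i j) (v j).

Lemma mx_op_bounded (X : opSpace R) n (x : 'M[X]_n) :
  (eopnorm (@l2norm (os_hilb X) n) (@l2norm (os_hilb X) n) (mx_op x) < +oo)%E.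
Proof.
pose M i j := fine (eopnorm (@rnorm R _) (@rnorm R _) (os_op (x i j))).
apply: (@le_lt_trans _ _ (Num.sqrt (\sum_i (\sum_j M i j) ^+ 2))%:E);
  last by rewrite ltry.
apply: ge_ereal_sup => _ [v /= v1 <-]; rewrite lee_fin.
have vj1 j : rnorm (v j) <= 1.
  apply: le_trans v1; rewrite /l2norm -[leLHS]ger0_norm ?rnorm_ge0//.
  rewrite -sqrtr_sqr ler_wsqrtr// (bigD1 j)//= lerDl sumr_ge0// => k _.
  by rewrite sqr_ge0.
rewrite ler_wsqrtr// ler_sum// => i _.
have xv_ge0 := rnorm_ge0 (mx_op x v i).
have xvM : rnorm (mx_op x v i) <= \sum_j M i j.
  rewrite /mx_op; elim/big_ind2 : _ => [|a b c d ab cd|j _].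
  - by rewrite rnorm0.
  - by rewrite (le_trans (rnormD _ _))// lerD.
  - exact: bop_norm_ub.
by rewrite ler_sqr// nnegrE// (le_trans xv_ge0).
Qed.

(* The value is finite by [mx_op_bounded]. *)
Definition mxnorm (X : opSpace R) n (x : 'M[X]_n) : R :=
  fine (eopnorm (@l2norm (os_hilb X) n) (@l2norm (os_hilb X) n) (mx_op x)).

Definition cbnorm (X Y : opSpace R) (u : X -> Y) : \bar R :=
  ereal_sup [set eopnorm (@mxnorm X n) (@mxnorm Y n) (map_mx u)
            | n in [set n | (0 < n)%N]].

Definition homogeneous (X : opSpace R) : Prop :=
  forall u : {linear X -> X},
    (eopnorm (@rnorm R X) (@rnorm R X) u < +oo)%E ->
    cbnorm u = eopnorm (@rnorm R X) (@rnorm R X) u.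

Definition hilbert_isometry (X : opSpace R) (K : hilbertSpace R)
    (T : {linear X -> K}) : Prop :=
  (forall x, `|T x| = `|x|) /\ range T = setT.

Definition hilbertian (X : opSpace R) : Prop :=
  exists (K : hilbertSpace R) (T : {linear X -> K}), hilbert_isometry T.

Definition finite_dimensional (X : opSpace R) : Prop :=
  exists n (e : 'I_n -> X), forall x,
    exists a : 'I_n -> R[i], x = \sum_i a i *: e i.

(* Orthonormality in a Hilbertian space: the inner product is the one
   transported from any Hilbert space isometric to X. *)
Definition orthonormal_family (X : opSpace R) n (e : 'I_n -> X) : Prop :=
  exists (K : hilbertSpace R) (T : {linear X -> K}), hilbert_isometry T /\
    forall i j, hs_dot K (T (e i)) (T (e j)) = (i == j)%:R.

Definition first_col (X : opSpace R) n (e : 'I_n -> X) : 'M[X]_n :=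
  \matrix_(i, j) if j == 0 :> nat then e i else 0.

(* The orthonormal family is picked arbitrarily; for homogeneous X the value
   does not depend on it. *)
Definition kappa (X : opSpace R) (n : nat) : R :=
  mxnorm (first_col
    (xget (fun=> 0) [set e : 'I_n -> X | orthonormal_family e])).

Definition unit_ball (X : opSpace R) : set X := [set x | `|x| <= 1].

(* f is a total function, but only its values on the unit ball matter: the
   entries of a matrix of norm at most 1 have norm at most 1. *)
Definition completely_almost_uncollapsed (X Y : opSpace R) (f : X -> Y) : Prop :=
  exists t eps : R, [/\ 0 < t, t < 1, 0 < eps &
    forall n (x z : 'M[X]_n), (0 < n)%N -> mxnorm x <= 1 -> mxnorm z <= 1 ->
      mxnorm (x - z) = t -> eps <= mxnorm (map_mx f x - map_mx f z)].

Definition lesssim (a b : nat -> R) : Prop :=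
  exists2 K : R, 0 < K & forall n, (0 < n)%N -> a n <= K * b n.

End matrices.

Arguments unit_ball {R} X _ : rename.

(* Main.v *)
From HB Require Import structures.
Require Import Defs.
From mathcomp Require Import all_boot all_order all_algebra.
From mathcomp Require Import all_classical all_reals all_analysis.
From mathcomp Require Import sesquilinear complex zify lra ring.
Set Implicit Arguments.
Unset Strict Implicit.
Unset Printing Implicit Defensive.
Import Order.TTheory GRing.Theory Num.Theory.
Import numFieldNormedType.Exports.
Local Open Scope classical_set_scope.
Local Open Scope ring_scope.
Local Open Scope complex_scope.

(** Write [k] for [kappa X n] and let [e_0, e_1, ...] be an infinite orthonormal
    sequence in [X]. Put [s = t / (sqrt 2 k)]. For indices [p_i <> q_i], all
    distinct, the column [x] of the vectors [s e_(p_i)] and the column [z] of the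
    vectors [s e_(q_i)] have norm [t / sqrt 2], and [x - z] is [s sqrt 2] times
    the column of the orthonormal vectors [(e_(p_i) - e_(q_i)) / sqrt 2], so it
    has norm exactly [t]. As [f] is completely almost uncollapsed, the column of
    the differences [y_i = f (s e_(p_i)) - f (s e_(q_i))] has norm at least
    [eps], whereas each [y_i] has norm at most [M = L t / k], where [L] is the
    Lipschitz constant.

    If the [y_i] were orthogonal, homogeneity of [Y] would bound the norm of their
    column by [M kappa Y n], and the theorem would follow. The freedom in the
    choice of the pairs makes them almost orthogonal: the vectors [f (s e_j)]
    form a bounded sequence, so its inner products with the finitely many
    differences chosen before can be made nearly equal at two further indices,
    by the pigeonhole principle ([almost_orthogonal_pairs]). The Gram matrix of
    the [y_i] is then close enough to a diagonal one for the map sending an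
    orthonormal family of [Y] to the [y_i] to have norm at most [sqrt 2 M]
    ([gram_bound]), and homogeneity of [Y] turns this into a bound on the column
    ([column_le]). Hence [eps <= sqrt 2 L t kappa Y n / k]. *)

(** * Norms of matrices over an operator space *)

Section matrix_norms.
Context {R : realType}.
Implicit Types (X : opSpace R) (H : hilbertSpace R).

Lemma eopnorm_ub (V W : Type) (N : V -> R) (N' : W -> R) (f : V -> W) v :
  N v <= 1 -> ((N' (f v))%:E <= eopnorm N N' f)%E.
Proof. by move=> v1; apply: ereal_sup_ubound; exists v. Qed.

Lemma eopnorm_le (V W : Type) (N : V -> R) (N' : W -> R) (f : V -> W) (M : R) :
  (forall v, N v <= 1 -> N' (f v) <= M) -> (eopnorm N N' f <= M%:E)%E.
Proof. by move=> fM; apply: ge_ereal_sup => _ [v v1 <-]; rewrite lee_fin fM. Qed.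

Lemma l2norm_ge0 H n (v : 'I_n -> H) : 0 <= l2norm v.
Proof. exact: sqrtr_ge0. Qed.

Lemma l2norm_cst0 H n : @l2norm R H n (fun=> 0) = 0.
Proof.
by rewrite /l2norm big1 ?sqrtr0// => i _; rewrite rnorm0 expr0n.
Qed.

Lemma l2norm_delta H n (j : 'I_n) (h : H) :
  l2norm (fun i => if i == j then h else 0) = rnorm h.
Proof.
rewrite /l2norm (bigD1 j)//= eqxx big1 ?addr0 => [|i /negPf ->].
  by rewrite sqrtr_sqr ger0_norm// rnorm_ge0.
by rewrite rnorm0 expr0n.
Qed.

Lemma rnorm_le_l2norm H n (v : 'I_n -> H) i :
  rnorm (v i) <= l2norm v.
Proof.
rewrite /l2norm -[leLHS]ger0_norm ?rnorm_ge0// -sqrtr_sqr ler_wsqrtr//.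
by rewrite (bigD1 i)//= lerDl sumr_ge0// => k _; rewrite sqr_ge0.
Qed.

Lemma l2normZ H n (c : R) (v : 'I_n -> H) :
  l2norm (fun i => c%:C *: v i) = `|c| * l2norm v.
Proof.
rewrite /l2norm -sqrtr_sqr -sqrtrM ?sqr_ge0//; congr Num.sqrt.
rewrite mulr_sumr; apply: eq_bigr => i _.
by rewrite rnormZ normc_def/= expr0n addr0 sqrtr_sqr exprMn real_normK ?num_real.
Qed.

Lemma mxnorm_ub X n (x : 'M[X]_n) v :
  l2norm v <= 1 -> l2norm (mx_op x v) <= mxnorm x.
Proof.
move=> v1; rewrite -lee_fin fineK; first exact: eopnorm_ub.
rewrite ge0_fin_numE ?mx_op_bounded//.
by apply: le_trans (eopnorm_ub _ _ v1); rewrite lee_fin l2norm_ge0.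
Qed.

Lemma mxnorm_ge0 X n (x : 'M[X]_n) : 0 <= mxnorm x.
Proof.
apply: (le_trans (l2norm_ge0 (mx_op x (fun=> 0)))).
by apply: mxnorm_ub; rewrite l2norm_cst0 ler01.
Qed.

Lemma mxnorm_le X n (x : 'M[X]_n) (M : R) :
  (forall v, l2norm v <= 1 -> l2norm (mx_op x v) <= M) -> mxnorm x <= M.
Proof.
move=> xM; rewrite -lee_fin fineK; first exact: eopnorm_le.
rewrite ge0_fin_numE ?mx_op_bounded//.
apply: (@le_trans _ _ (l2norm (mx_op x (fun=> 0)))%:E).
  by rewrite lee_fin l2norm_ge0.
by apply: eopnorm_ub; rewrite l2norm_cst0 ler01.
Qed.

Lemma mxnorm_entry X n (x : 'M[X]_n) i j : rnorm (x i j) <= mxnorm x.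
Proof.
apply: bop_norm_le => h h1.
set v := fun k => if k == j then h else 0.
have -> : os_op (x i j) h = mx_op x v i.
  rewrite /mx_op (bigD1 j)//= /v eqxx big1 ?addr0// => k /negPf ->.
  exact: linear0.
by apply: (le_trans (rnorm_le_l2norm _ _)); apply: mxnorm_ub; rewrite l2norm_delta.
Qed.

Definition scale_mx X n (c : R) (x : 'M[X]_n) : 'M[X]_n :=
  map_mx (fun y => c%:C *: y) x.

Lemma mxnormZ_le X n (c : R) (x : 'M[X]_n) :
  mxnorm (scale_mx c x) <= `|c| * mxnorm x.
Proof.
apply: mxnorm_le => v v1.
have -> : mx_op (scale_mx c x) v = fun i => c%:C *: mx_op x v i.
  by apply/funext => i; rewrite /mx_op scaler_sumr; apply: eq_bigr => j _; rewrite mxE.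
by rewrite l2normZ ler_wpM2l// mxnorm_ub.
Qed.

Lemma mxnormZ X n (c : R) (x : 'M[X]_n) :
  mxnorm (scale_mx c x) = `|c| * mxnorm x.
Proof.
apply/eqP; rewrite eq_le mxnormZ_le/=.
have [->|c0] := eqVneq c 0; first by rewrite normr0 mul0r mxnorm_ge0.
have cV : scale_mx c^-1 (scale_mx c x) = x.
  by apply/matrixP => i j; rewrite !mxE scalerA -rmorphM mulVf// scale1r.
rewrite -{1}cV (le_trans (ler_wpM2l _ (mxnormZ_le _ _)))//.
by rewrite mulrA -normrM mulfV// normr1 mul1r.
Qed.

(** Homogeneity only bounds the amplified map on the closed unit ball; dividing
    [x] by any number above its norm extends the bound to all matrices. *)
Lemma homogeneous_map_mx X (u : {linear X -> X}) (M : R) :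
  homogeneous X -> 0 <= M -> (forall x, rnorm (u x) <= M * rnorm x) ->
  forall n (x : 'M[X]_n), (0 < n)%N -> mxnorm (map_mx u x) <= M * mxnorm x.
Proof.
move=> homX M0 uM n x n0.
have uleM : (eopnorm (@rnorm R X) (@rnorm R X) u <= M%:E)%E.
  apply: eopnorm_le => v v1; apply: (le_trans (uM v)).
  by rewrite -[leRHS]mulr1 ler_wpM2l.
have cbM : (cbnorm u <= M%:E)%E by rewrite homX// (le_lt_trans uleM)// ltry.
have ball (z : 'M[X]_n) : mxnorm z <= 1 -> mxnorm (map_mx u z) <= M.
  move=> z1; rewrite -lee_fin; apply: le_trans cbM.
  apply: (@le_trans _ _ (eopnorm (@mxnorm R X n) (@mxnorm R X n) (map_mx u))).
    exact: eopnorm_ub.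
  by apply: ereal_sup_ubound; exists n.
have scaled r : mxnorm x < r -> mxnorm (map_mx u x) <= r * M.
  move=> xr; have r0 : 0 < r := le_lt_trans (mxnorm_ge0 _) xr.
  have -> : map_mx u x = scale_mx r (map_mx u (scale_mx r^-1 x)).
    apply/matrixP => i j; rewrite !mxE linearZ scalerA -rmorphM.
    by rewrite mulfV ?gt_eqF// scale1r.
  rewrite mxnormZ gtr0_norm// ler_pM2l// ball// mxnormZ gtr0_norm ?invr_gt0//.
  by rewrite ler_pdivrMl// mulr1 ltW.
rewrite mulrC; have [M_eq0|M_neq0] := eqVneq M 0.
  by have := scaled (mxnorm x + 1); rewrite ltrDl ltr01 M_eq0 !mulr0; apply.
have M_gt0 : 0 < M by rewrite lt_def M_neq0.
rewrite -ler_pdivrMr//; apply/ler_addgt0Pr => e e0.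
by rewrite ler_pdivrMr// scaled// ltrDl.
Qed.

End matrix_norms.

(** * Gram matrices in a Hilbert space *)

Section gram.
Context {R : realType} (K : hilbertSpace R).
Local Notation d := (hs_dot K).
Implicit Types (u v w : K).

Lemma dot_sum n (a b : 'I_n -> R[i]) (y z : 'I_n -> K) :
  d (\sum_i a i *: y i) (\sum_j b j *: z j) =
  \sum_i \sum_j a i * (b j)^*%R * d (y i) (z j).
Proof.
rewrite linear_sumlz; apply: eq_bigr => i _.
rewrite linear_sumr; apply: eq_bigr => j _.
by rewrite linearZl_LR linearZr_LR/= mulrA.
Qed.

Lemma dot_orthonormal_sum n (a b : 'I_n -> R[i]) (e : 'I_n -> K) :
  (forall i j, d (e i) (e j) = (i == j)%:R) ->
  d (\sum_i a i *: e i) (\sum_j b j *: e j) = \sum_i a i * (b i)^*%R.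
Proof.
move=> ee; rewrite dot_sum; apply: eq_bigr => i _.
rewrite (bigD1 i)//= big1 ?addr0 => [|j /negPf ji].
  by rewrite ee eqxx mulr1.
by rewrite ee eq_sym ji mulr0.
Qed.

(** This is Schur's test for the Gram matrix of [y]: each off-diagonal term is
    absorbed by [2 |a_i| |a_j| <= |a_i|^2 + |a_j|^2]. *)
Lemma gram_bound n (y : 'I_n -> K) (A delta : R[i]) : 0 <= delta ->
  (forall i, d (y i) (y i) <= A) ->
  (forall i j, i != j -> `|d (y i) (y j)| <= delta) ->
  forall a : 'I_n -> R[i],
    `|\sum_i a i *: y i| ^+ 2 <= (A + n%:R * delta) * \sum_i `|a i| ^+ 2.
Proof.
move=> delta0 yA ydelta a.
rewrite hs_normE -[leLHS]ger0_norm ?dnorm_ge0// dot_sum.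
apply: (le_trans (ler_norm_sum _ _ _)).
pose m i j := delta / 2 * (`|a i| ^+ 2 + `|a j| ^+ 2).
apply: (@le_trans _ _ (\sum_i (A * `|a i| ^+ 2 + \sum_j m i j))).
  apply: ler_sum => i _; apply: (le_trans (ler_norm_sum _ _ _)).
  rewrite (bigD1 i)//= [X in _ <= _ + X](bigD1 i)//= addrA; apply: lerD.
    rewrite !normrM norm_conjC -expr2 [leLHS]mulrC.
    rewrite (ger0_norm (dnorm_ge0 _ _)) ler_wpDr//; last exact: ler_wpM2r.
    by rewrite /m mulr_ge0// ?divr_ge0// addr_ge0.
  apply: ler_sum => j ji; rewrite !normrM norm_conjC.
  apply: (@le_trans _ _ (`|a i| * `|a j| * delta)).
    by rewrite ler_wpM2l ?mulr_ge0// ydelta// eq_sym.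
  rewrite /m [leLHS]mulrC -mulrA ler_wpM2l// ler_pdivlMl//.
  rewrite -subr_ge0.
  have -> : `|a i| ^+ 2 + `|a j| ^+ 2 - 2 * (`|a i| * `|a j|) =
            (`|a i| - `|a j|) ^+ 2 by ring.
  by rewrite real_exprn_even_ge0// rpredB// normr_real.
rewrite big_split/= -mulr_sumr mulrDl lerD2l.
rewrite /m; under eq_bigr do rewrite -mulr_sumr big_split/= sumr_const card_ord.
rewrite -mulr_sumr big_split/= sumr_const card_ord sumrMnl.
rewrite le_eqVlt; apply/orP; left; apply/eqP.
by set S := \sum_i _; rewrite -[S *+ n]mulr_natl; field.
Qed.

Lemma bessel n (e : 'I_n -> K) v :
  (forall i j, d (e i) (e j) = (i == j)%:R) ->
  \sum_i `|d v (e i)| ^+ 2 <= `|v| ^+ 2.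
Proof.
move=> ee; pose p := \sum_i d v (e i) *: e i.
(* [p] is the projection of [v]; the gap in the inequality is [|v - p|^2]. *)
have sumE : \sum_i `|d v (e i)| ^+ 2 = d p p.
  rewrite dot_orthonormal_sum//; apply: eq_bigr => i _.
  by rewrite normCK.
have vp : d v p = d p p.
  rewrite -sumE linear_sumr; apply: eq_bigr => i _.
  by rewrite linearZr_LR/= normCK mulrC.
have := dnorm_ge0 d (v - p); rewrite dnormB vp.
have -> : (d p p)^*%R = d p p by rewrite geC0_conj// dnorm_ge0.
by rewrite opprD addrA addrK subr_ge0 sumE hs_normE.
Qed.

(** Bessel's inequality for the single unit vector [w / |w|]. *)
Lemma cauchy_schwarz v w : `|d v w| <= `|v| * `|w|.
Proof.
have [->|w0] := eqVneq w 0; first by rewrite linear0r !normr0 mulr0.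
have nw0 : `|w| != 0 by rewrite normr_eq0.
pose e (i : 'I_1) := `|w|^-1 *: w.
have ee i j : d (e i) (e j) = (i == j)%:R.
  rewrite !ord1 eqxx linearZl_LR linearZr_LR/= -hs_normE.
  by rewrite geC0_conj ?invr_ge0// expr2 mulKf// mulVf.
have := bessel v ee; rewrite big_ord1 linearZr_LR/= normrM norm_conjC.
rewrite ler_pXn2r ?nnegrE ?mulr_ge0// normfV normr_id.
by rewrite ler_pdivrMl ?normr_gt0// mulrC.
Qed.

End gram.

(** Disjointness of the pairs is what makes the differences orthogonal, and
    [sqrt 2] is the common norm of the [e (p i) - e (q i)]. *)
Lemma orthonormal_differences {R : realType} (K : hilbertSpace R) (e : nat -> K)
    n (p q : 'I_n -> nat) :
  (forall i j, hs_dot K (e i) (e j) = (i == j)%:R) ->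
  (forall i, p i != q i) ->
  (forall i j, i != j -> [&& p i != p j, q i != q j & p i != q j]) ->
  forall i j, hs_dot K ((Num.sqrt 2)^-1%:C *: (e (p i) - e (q i)))
                       ((Num.sqrt 2)^-1%:C *: (e (p j) - e (q j))) = (i == j)%:R.
Proof.
move=> ee pq pqij i j.
rewrite linearZl_LR linearZr_LR/= linearBl !linearBr/= !ee.
have r2 : (Num.sqrt 2 : R) != 0 by rewrite gt_eqF// sqrtr_gt0.
have -> : ((Num.sqrt 2)^-1%:C)^*%R = (Num.sqrt 2 : R)^-1%:C.
  by rewrite geC0_conj// ler0c invr_ge0 sqrtr_ge0.
have [<-|ij] := eqVneq i j.
  rewrite !eqxx [q i == p i]eq_sym (negPf (pq i)) /= !mulr0n !mulr0 !mulr1.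
  rewrite !subr0 sub0r opprK -rmorphM -rmorphD/= -[RHS](rmorph1 (real_complex R)).
  by congr (_%:C); rewrite -invfM -expr2 sqr_sqrtr//; lra.
have /and3P[/negPf -> /negPf -> /negPf ->] := pqij _ _ ij.
rewrite eq_sym in ij.
have /and3P[_ _] := pqij _ _ ij; rewrite eq_sym => /negPf ->; rewrite /= !mulr0n.
by rewrite !mulr0 !subrr.
Qed.

(** * Pigeonhole selection of almost orthogonal differences *)

(** Cut [[-B, B]] into cells of length [delta]: the cells of the values [c k i],
    for all [i] at once, take finitely many values as [k] varies. *)
Lemma pigeonhole_close {R : realType} (I : finType) (c : nat -> I -> R)
    (B delta : R) : 0 < delta -> (forall k i, `|c k i| <= B) ->
  forall N, exists j k, [/\ (N <= j)%N, (j < k)%N &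
    forall i, `|c j i - c k i| <= delta].
Proof.
move=> delta0 cB N.
pose cell j i := Num.truncn ((c j i + B) / delta).
pose m := Num.truncn ((B + B) / delta).
have pos j i : 0 <= (c j i + B) / delta.
  have := cB j i; rewrite ler_norml => /andP[cBl _].
  by rewrite divr_ge0 ?(ltW delta0)// -lerBlDr sub0r.
have cell_le j i : (cell j i < m.+1)%N.
  rewrite ltnS; apply: le_truncn; rewrite ler_pM2r ?invr_gt0// lerD2r.
  by apply: le_trans (cB j i); exact: ler_norm.
have same j k i : cell j i = cell k i -> `|c j i - c k i| <= delta.
  move=> jk; have /andP[] := truncn_itv (pos j i).
  have /andP[] := truncn_itv (pos k i).
  rewrite -!/(cell _ _) jk !ler_pdivlMr// !ltr_pdivrMr// -natr1 mulrDl mul1r.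
  by rewrite ler_norml => ? ? ? ?; apply/andP; split; lra.
pose T := {ffun I -> 'I_m.+1}.
pose g (j : 'I_#|T|.+1) : T := [ffun i => Ordinal (cell_le (N + j)%N i)].
have [j [k [jk gjk]]] : exists j k, j != k /\ g j = g k.
  apply: contrapT => no; have /leq_card : injective g.
    by move=> j k gjk; apply/eqP/negP => /negP jk; apply: no; exists j, k.
  by rewrite card_ord ltnn.
have close i : `|c (N + j)%N i - c (N + k)%N i| <= delta.
  by apply: same; have /ffunP/(_ i) := gjk; rewrite !ffunE => -[].
have [kj|kj|/val_inj kj] := ltngtP j k.
- by exists (N + j)%N, (N + k)%N; split => //; rewrite ?leq_addr// ltn_add2l.
- exists (N + k)%N, (N + j)%N; split => [||i]; rewrite ?leq_addr ?ltn_add2l//.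
  by rewrite distrC.
- by rewrite kj eqxx in jk.
Qed.

Section selection.
Context {R : realType} (K : hilbertSpace R).
Local Notation d := (hs_dot K).
Variables (v : nat -> K) (B : R).
Hypothesis vB : forall k, `|v k| <= B%:C.

(** By Cauchy-Schwarz the real and imaginary parts of the inner products with the
    [w i] are bounded functions of the index, to which the pigeonhole principle
    applies. *)
Lemma almost_orthogonal_difference (delta : R) m (w : 'I_m -> K) N :
  0 < delta -> exists j k, [/\ (N <= j)%N, (j < k)%N &
    forall i, `|d (v j - v k) (w i)| <= delta%:C].
Proof.
move=> delta0.
pose c k (bi : bool * 'I_m) := let z := d (v k) (w bi.2) in
  if bi.1 then complex.Im z else complex.Re z.
pose W := \sum_i complex.Re `|w i|.
have cB k bi : `|c k bi| <= B * W.
  have BW (z : R[i]) : `|z| = `|d (v k) (w bi.2)| -> `|complex.Re z| <= B * W.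
    move=> zE; rewrite -lecR; apply: (le_trans (normc_ge_Re z)).
    rewrite zE (le_trans (cauchy_schwarz _ _))// rmorphM/= ler_pM//.
    rewrite rnormE lecR /W (bigD1 bi.2)//= lerDl sumr_ge0// => i _.
    exact: rnorm_ge0.
  rewrite /c; case: bi.1; last exact: BW.
  by rewrite -[X in X <= _]normrN -ReiNIm BW// normrM complexiE normCi mulr1.
have delta20 : 0 < delta / 2 by rewrite divr_gt0.
have [j [k [Nj jk close]]] := pigeonhole_close delta20 cB N.
exists j, k; split => // i.
rewrite linearBl /= [X in `|X|]complexE.
apply: (le_trans (ler_normD _ _)).
rewrite normrM complexiE normCi mul1r [delta]splitr rmorphD/= lerD//.
  rewrite normc_def/= expr0n addr0 sqrtr_sqr lecR.
  by have := close (false, i); rewrite /c/= -raddfB.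
rewrite normc_def/= expr0n addr0 sqrtr_sqr lecR.
by have := close (true, i); rewrite /c/= -raddfB.
Qed.

(** Greedy choice: each new pair lies beyond the indices of the previous pairs,
    and its difference is almost orthogonal to theirs. *)
Lemma almost_orthogonal_pairs (delta : R) n : 0 < delta ->
  exists p q : 'I_n -> nat, [/\ forall i, p i != q i,
    forall i j, i != j -> [&& p i != p j, q i != q j & p i != q j] &
    forall i j, i != j ->
      `|d (v (p i) - v (q i)) (v (p j) - v (q j))| <= delta%:C].
Proof.
move=> delta0.
pose y (a : nat * nat) := v a.1 - v a.2.
pose r (b a : nat * nat) := (a.2 < b.1)%N && `[< `|d (y b) (y a)| <= delta%:C >].
(* New pairs go to the front, so [r b a] speaks of a pair [b] chosen after [a]. *)
have [s [sn s_lt s_r]] : exists s : seq (nat * nat),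
    [/\ size s = n, all (fun a => a.1 < a.2)%N s & pairwise r s].
  elim: n => [|n [s [sn s_lt s_r]]]; first by exists [::].
  pose w (i : 'I_n) := y (nth (0, 0)%N s i).
  have [j [k [Nj jk close]]] :=
    almost_orthogonal_difference w (\max_(a <- s) a.2).+1 delta0.
  exists ((j, k) :: s); split; rewrite /= ?sn ?jk//.
  rewrite s_r andbT; apply/(all_nthP (0, 0)%N) => i; rewrite sn => i_n.
  apply/andP; split; last by apply/asboolP; exact: (close (Ordinal i_n)).
  apply: leq_trans Nj; rewrite ltnS.
  by apply: (@leq_bigmax_seq _ s xpredT (fun a => a.2)) => //; rewrite mem_nth// sn.
pose a (i : 'I_n) := nth (0, 0)%N s i.
have a_lt i : ((a i).1 < (a i).2)%N.
  by move/(all_nthP (0, 0)%N) : s_lt; apply; rewrite sn.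
have a_r (i j : 'I_n) : (i < j)%N -> r (a i) (a j).
  by move/(pairwiseP (0, 0)%N) : s_r => s_r; apply: s_r; rewrite inE sn.
exists (fun i => (a i).1), (fun i => (a i).2); split => [i|i j ij|i j ij].
- by rewrite neq_ltn a_lt.
- have [lt|lt|/val_inj eq] := ltngtP i j; last by rewrite eq eqxx in ij.
    by have := a_r _ _ lt => /andP[+ _]; have := a_lt i; have := a_lt j; lia.
  by have := a_r _ _ lt => /andP[+ _]; have := a_lt i; have := a_lt j; lia.
- have [lt|lt|/val_inj eq] := ltngtP i j; last by rewrite eq eqxx in ij.
    by have := a_r _ _ lt => /andP[_ /asboolP].
  have := a_r _ _ lt => /andP[_ /asboolP].
  by rewrite hermC/= expr0 mul1r norm_conjC.
Qed.

End selection.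

(** * Columns over a homogeneous Hilbertian operator space *)

Section first_columns.
Context {R : realType} (X Y : opSpace R).

Lemma first_colZ n (c : R) (x : 'I_n -> X) :
  first_col (fun i => c%:C *: x i) = scale_mx c (first_col x).
Proof. by apply/matrixP => i j; rewrite !mxE; case: ifP => // _; rewrite scaler0. Qed.

Lemma first_colB n (x z : 'I_n -> X) :
  first_col x - first_col z = first_col (fun i => x i - z i).
Proof. by apply/matrixP => i j; rewrite !mxE; case: ifP => // _; rewrite subrr. Qed.

Lemma map_first_colB n (f : X -> Y) (x z : 'I_n -> X) :
  map_mx f (first_col x) - map_mx f (first_col z) =
  first_col (fun i => f (x i) - f (z i)).
Proof. by apply/matrixP => i j; rewrite !mxE; case: ifP => // _; rewrite subrr. Qed.

End first_columns.

Section columns.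
Context {R : realType} (X : opSpace R).

Section synthesis.
Variables (K : hilbertSpace R) (T : {linear X -> K}) (n : nat) (e y : 'I_n -> X).

(** When [e] is orthonormal, this sends each [e i] to [y i] and kills the
    orthogonal complement of [e]. *)
Definition synthesis (x : X) : X := \sum_i hs_dot K (T x) (T (e i)) *: y i.

Lemma synthesis_linear : linear synthesis.
Proof.
move=> a u v; rewrite /synthesis scaler_sumr -big_split; apply: eq_bigr => i _.
by rewrite linearP linearDl linearZl_LR scalerDl scalerA.
Qed.

HB.instance Definition _ :=
  GRing.isLinear.Build R[i] X X *:%R synthesis synthesis_linear.

End synthesis.

(** The column of [y] is the image of the column of [e] under the amplification of
    [synthesis], whose norm is at most [M] by Bessel's inequality and the
    hypothesis on [y]; homogeneity makes [M] a bound for the amplification. *)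
Lemma column_le n (e y : 'I_n -> X) (M : R) :
  homogeneous X -> orthonormal_family e -> (0 < n)%N -> 0 <= M ->
  (forall a : 'I_n -> R[i],
    `|\sum_i a i *: y i| ^+ 2 <= (M ^+ 2)%:C * \sum_i `|a i| ^+ 2) ->
  mxnorm (first_col y) <= M * mxnorm (first_col e).
Proof.
move=> homX [K [T [[Tiso _] Te]]] n0 M0 yM.
have -> : first_col y = map_mx (synthesis T e y) (first_col e).
  apply/matrixP => i j; rewrite !mxE; case: ifP => _; last by rewrite linear0.
  rewrite /synthesis (bigD1 i)//= big1 => [|k /negPf ki].
    by rewrite Te eqxx scale1r addr0.
  by rewrite Te eq_sym ki scale0r.
apply: homogeneous_map_mx => // x.
rewrite -lecR -rnormE rmorphM/= -rnormE -(@ler_pXn2r _ 2) ?nnegrE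
  ?mulr_ge0 ?normr_ge0 ?ler0c//.
apply: (le_trans (yM _)); rewrite exprMn rmorphXn/= ler_wpM2l ?exprn_ge0 ?ler0c//.
by rewrite -Tiso; exact: bessel.
Qed.

(** The map sending one orthonormal family to another is a contraction, even if
    the two are orthonormal for different Hilbert space structures on [X]; so the
    two columns have norms bounded by each other. *)
Lemma kappaE n (e : 'I_n -> X) : homogeneous X -> (0 < n)%N ->
  orthonormal_family e -> kappa X n = mxnorm (first_col e).
Proof.
move=> homX n0 one.
have indep (e1 e2 : 'I_n -> X) : orthonormal_family e1 -> orthonormal_family e2 ->
    mxnorm (first_col e1) <= mxnorm (first_col e2).
  move=> [K [T [[Tiso _] Te]]] one2; rewrite -[leRHS]mul1r.
  apply: column_le => // a; rewrite expr1n rmorph1 -Tiso linear_sum/=.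
  under eq_bigr do rewrite linearZ.
  rewrite -[X in X * _](addr0 1) -[X in _ + X](mulr0 n%:R).
  apply: gram_bound => // [i|i j /negPf ij]; first by rewrite Te eqxx.
  by rewrite Te ij normr0.
rewrite /kappa; case: xgetP => [e1 _ one1|/(_ e)//].
by apply/eqP; rewrite eq_le !indep.
Qed.

(** Gram-Schmidt: a finite orthonormal list does not span [X], so subtracting from
    a vector outside its span the projection onto it and normalizing gives one
    more vector. *)
Lemma orthonormal_sequence (K : hilbertSpace R) (T : {linear X -> K}) :
  ~ finite_dimensional X -> (forall x, `|T x| = `|x|) ->
  exists e : nat -> X, forall i j, hs_dot K (T (e i)) (T (e j)) = (i == j)%:R.
Proof.
move=> infX Tiso.
pose d x y := hs_dot K (T x) (T y).
pose ons (s : seq X) := all (fun x => d x x == 1) s &&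
  pairwise (fun x y => d x y == 0) s.
have ons_nth s i j : ons s -> (i < size s)%N -> (j < size s)%N ->
    d (nth 0 s i) (nth 0 s j) = (i == j)%:R.
  move=> /andP[/(all_nthP 0) s1 /(pairwiseP 0) s0] i_s j_s.
  have [lt|lt|->] := ltngtP i j; last by rewrite (eqP (s1 _ _)) ?eqxx.
    by rewrite (eqP (s0 _ _ _ _ lt)).
  by apply/eqP; rewrite /d herm_eq0C; exact: s0.
have extend s : ons s -> exists x, ons (x :: s).
  move=> s_on.
  have [x xE] : exists x, x != \sum_(i < size s) d x (nth 0 s i) *: nth 0 s i.
    apply: contrapT => no; apply: infX; exists (size s), (fun i => nth 0 s i) => x.
    exists (fun i => d x (nth 0 s i)); apply/eqP/negP => /negP xE.
    by apply: no; exists x.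
  set p := \sum_(i < _) _ in xE.
  pose z := x - p.
  have Tz0 : `|T z| != 0 by rewrite Tiso normr_eq0 subr_eq0.
  have dz i : (i < size s)%N -> d z (nth 0 s i) = 0.
    move=> i_s; rewrite /d linearB/= linearBl /p linear_sum linear_sumlz.
    rewrite (bigD1 (Ordinal i_s))//= big1 ?addr0 => [|k ki].
      by rewrite linearZ linearZl_LR/= [X in _ * X](ons_nth s) ?eqxx// mulr1 subrr.
    rewrite linearZ linearZl_LR/= [X in _ * X](ons_nth s)//.
    by move: ki; rewrite -val_eqE/= => /negPf ->; rewrite mulr0.
  exists (`|T z|^-1 *: z); move: s_on => /andP[s1 s0].
  rewrite /ons/= s1 s0 !andbT; apply/andP; split.
    rewrite /d linearZ linearZl_LR linearZr_LR/= -hs_normE.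
    by rewrite geC0_conj ?invr_ge0// expr2 mulKf// mulVf.
  apply/(all_nthP 0) => i i_s.
  by rewrite /d linearZ linearZl_LR/= [hs_dot _ _ _]dz// mulr0.
have [next nextP] : {next : seq X -> X & forall s, ons s -> ons (next s :: s)}.
  apply: (@choice _ _ (fun s x => ons s -> ons (x :: s))) => s.
  have [s_on|s_off] := boolP (ons s); last by exists 0.
  by have [x xs] := extend s s_on; exists x.
pose g k := iter k (fun s => next s :: s) [::].
have g_on k : ons (g k) by elim: k => //= k; exact: nextP.
have g_size k : size (g k) = k by elim: k => //= k ->.
(* The newest vector is at the head of [g k], whence the index. *)
have g_nth k i : (i < k)%N -> nth 0 (g k) (k.-1 - i)%N = next (g i).
  elim: k => // k IH; rewrite ltnS leq_eqVlt => /predU1P[->|ik].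
    by rewrite /= subnn.
  rewrite /= -IH//; case: k ik {IH} => // k ik.
  by rewrite subSn// -ltnS.
exists (fun i => next (g i)) => i j.
have [ik jk] : (i < (maxn i j).+1)%N /\ (j < (maxn i j).+1)%N by lia.
rewrite -(g_nth _ _ ik) -(g_nth _ _ jk) [LHS](ons_nth (g (maxn i j).+1))//.
- by congr (_%:R); lia.
- by rewrite g_size; lia.
- by rewrite g_size; lia.
Qed.

End columns.

(** * From almost orthogonal differences to the comparison *)

Lemma lipschitz_rnorm {R : realType} (V W : normedModType R[i]) (A : set V)
    (f : V -> W) : [lipschitz f x | x in A] ->
  exists2 L : R, 0 < L & forall x y, A x -> A y ->
    rnorm (f x - f y) <= L * rnorm (x - y).
Proof.
move=> [M [M_real fM]].
pose L := `|complex.Re M| + 1.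
have L0 : 0 < L by rewrite ltr_wpDl.
exists L => // x y Ax Ay.
have ML : M < L%:C.
  by rewrite -(RRe_real M_real) ltcR (le_lt_trans (ler_norm _))// ltrDl.
have := fM _ ML (x, y); rewrite /= /globally/= => /(_ (conj Ax Ay)).
by rewrite !rnormE -rmorphM lecR.
Qed.

Theorem theorem5p6 (R : realType) (X Y : opSpace R)
    (X_homogeneous : homogeneous X) (X_hilbertian : hilbertian X)
    (X_infinite : ~ finite_dimensional X)
    (Y_homogeneous : homogeneous Y) (Y_hilbertian : hilbertian Y)
    (Y_infinite : ~ finite_dimensional Y) :
  (exists f : X -> Y, [lipschitz f x | x in unit_ball X] /\
                      completely_almost_uncollapsed f) ->
  lesssim (kappa X) (kappa Y).
Proof.
move=> [f [/lipschitz_rnorm[L L0 fL] [t [eps [t0 t1 eps0 f_unc]]]]].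
have [K [T [Tiso Tsurj]]] := X_hilbertian.
have [KY [TY [TYiso TYsurj]]] := Y_hilbertian.
have [e Te] := orthonormal_sequence X_infinite Tiso.
have [g TYg] := orthonormal_sequence Y_infinite TYiso.
set r2 := Num.sqrt (2 : R).
have r2_gt0 : 0 < r2 by rewrite sqrtr_gt0.
have r2r2 : r2 ^+ 2 = 2 by rewrite sqr_sqrtr.
have r2_ge1 : 1 <= r2 by rewrite -sqrtr1 ler_wsqrtr// ler1n.
exists (r2 * L * t / eps) => [|n n0].
  by rewrite divr_gt0// !mulr_gt0.
have col_e (p : 'I_n -> nat) : injective p ->
    kappa X n = mxnorm (first_col (e \o p)).
  move=> p_inj; apply: kappaE => //; exists K, T; split => // i j.
  by rewrite Te inj_eq.
have e1 k : rnorm (e k) = 1.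
  apply/eqP; rewrite -(@eqrXn2 _ 2) ?rnorm_ge0//; apply/eqP/complexI.
  by rewrite rmorphXn/= -rnormE -Tiso hs_normE Te eqxx expr1n.
set k := kappa X n.
(* A column is at least as large as each of its unit entries; this makes [s <= 1],
   so that the vectors [s e_j] lie in the unit ball. *)
have k_ge1 : 1 <= k.
  rewrite /k (col_e (@nat_of_ord n)); last exact: val_inj.
  apply: le_trans (mxnorm_entry _ (Ordinal n0) (Ordinal n0)).
  by rewrite mxE /= e1.
have k0 : 0 < k := lt_le_trans ltr01 k_ge1.
pose s := t / (r2 * k).
have s0 : 0 < s by rewrite divr_gt0// mulr_gt0.
have s1 : s <= 1.
  rewrite ler_pdivrMr ?mulr_gt0// mul1r (le_trans (ltW t1))//.
  by rewrite -[leLHS]mul1r ler_pM.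
have se_norm j : rnorm (s%:C *: e j) = s.
  by rewrite rnormZ e1 mulr1 ger0_norm ?ler0c// ltW.
have ball_se j : unit_ball X (s%:C *: e j).
  by rewrite /unit_ball/= rnormE se_norm lecR.
have ball_0 : unit_ball X 0 by rewrite /unit_ball/= normr0 ler01.
have k_ne0 : k != 0 by rewrite gt_eqF.
have r2_ne0 : r2 != 0 by rewrite gt_eqF.
pose v j := TY (f (s%:C *: e j)).
have vB j : `|v j| <= (rnorm (f 0) + L)%:C.
  rewrite /v TYiso rnormE lecR -[X in rnorm X](subrK (f 0)) [leRHS]addrC.
  rewrite (le_trans (rnormD _ _))// lerD2r (le_trans (fL _ _ _ _))//.
  by rewrite subr0 se_norm -[leRHS]mulr1 ler_wpM2l// ltW.
pose M := L * t / k.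
have M0 : 0 < M by rewrite divr_gt0// mulr_gt0.
(* With this precision the off-diagonal terms of the Gram matrix add at most
   [n * (M ^+ 2 / n) = M ^+ 2] to the diagonal bound [M ^+ 2]. *)
have delta0 : 0 < M ^+ 2 / n%:R by rewrite divr_gt0 ?exprn_gt0// ltr0n.
have [p [q [pq pq_disj y_orth]]] := almost_orthogonal_pairs vB n delta0.
have p_inj : injective p.
  by move=> i j pij; apply/eqP/negP => /negP/pq_disj/and3P[]; rewrite pij eqxx.
have q_inj : injective q.
  by move=> i j pij; apply/eqP/negP => /negP/pq_disj/and3P[_]; rewrite pij eqxx.
pose h i := r2^-1%:C *: (e (p i) - e (q i)).
have h_on i j : hs_dot K (T (h i)) (T (h j)) = (i == j)%:R.
  have Th l : T (h l) = r2^-1%:C *: ((T \o e) (p l) - (T \o e) (q l)).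
    by rewrite /h linearZ linearB.
  by rewrite !Th; apply: orthonormal_differences.
have kh : k = mxnorm (first_col h) by apply: kappaE => //; exists K, T.
pose x := first_col (fun i => s%:C *: e (p i)).
pose z := first_col (fun i => s%:C *: e (q i)).
have small (u : 'I_n -> nat) : injective u ->
    mxnorm (first_col (fun i => s%:C *: e (u i))) <= 1.
  move=> u_inj; rewrite first_colZ mxnormZ -(col_e _ u_inj) (gtr0_norm s0) -/k.
  have -> : s * k = t / r2 by rewrite /s; field; rewrite r2_ne0.
  by rewrite ler_pdivrMr// mul1r (le_trans (ltW t1)).
have xz : mxnorm (x - z) = t.
  have -> : x - z = scale_mx (s * r2) (first_col h).
    rewrite -first_colZ first_colB; congr first_col; apply/funext => i.
    by rewrite /h scalerA -rmorphM mulfK// scalerBr.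
  rewrite mxnormZ -kh (gtr0_norm (mulr_gt0 s0 r2_gt0)) /s.
  by field; rewrite k_ne0 r2_ne0.
have := f_unc n x z n0 (small _ p_inj) (small _ q_inj) xz.
rewrite map_first_colB => eps_le.
pose y i := f (s%:C *: e (p i)) - f (s%:C *: e (q i)).
have y_norm i : rnorm (y i) <= M.
  apply: (le_trans (fL _ _ (ball_se _) (ball_se _))).
  have -> : s%:C *: e (p i) - s%:C *: e (q i) = (s * r2)%:C *: h i.
    by rewrite /h scalerA -rmorphM mulfK// scalerBr.
  have h1 : rnorm (h i) = 1.
    apply/eqP; rewrite -(@eqrXn2 _ 2) ?rnorm_ge0//; apply/eqP/complexI.
    by rewrite rmorphXn/= -rnormE -Tiso hs_normE h_on eqxx expr1n.
  rewrite rnormZ h1 mulr1 ger0_norm ?ler0c ?(ltW (mulr_gt0 s0 r2_gt0))//=.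
  by rewrite /M /s le_eqVlt; apply/orP; left; apply/eqP; field; rewrite k_ne0 r2_ne0.
have Ty_orth i j : i != j ->
    `|hs_dot KY (TY (y i)) (TY (y j))| <= (M ^+ 2 / n%:R)%:C.
  by move=> ij; rewrite /y !(linearB TY); exact: y_orth.
have g_on : orthonormal_family (g \o @nat_of_ord n).
  by exists KY, TY; split => // i j; rewrite TYg.
have : mxnorm (first_col y) <= r2 * M * kappa Y n.
  rewrite (kappaE Y_homogeneous n0 g_on).
  apply: column_le => // [|a]; first by rewrite mulr_ge0// ltW.
  rewrite -TYiso linear_sum/=; under eq_bigr do rewrite linearZ.
  have -> : ((r2 * M) ^+ 2)%:C = (M ^+ 2)%:C + n%:R * (M ^+ 2 / n%:R)%:C.
    rewrite -(rmorph_nat (real_complex R)) -rmorphM -rmorphD; congr (_%:C).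
    rewrite exprMn r2r2; field.
    by rewrite pnatr_eq0 -lt0n.
  apply: gram_bound => //; first by rewrite ler0c ltW.
  move=> i; rewrite -hs_normE TYiso rnormE -rmorphXn lecR.
  by rewrite ler_pXn2r ?nnegrE ?rnorm_ge0// ltW.
move=> /(le_trans eps_le).
have -> : r2 * M * kappa Y n = (r2 * L * t * kappa Y n) / k by rewrite /M; field.
rewrite ler_pdivlMr// mulrC -ler_pdivlMr//.
by rewrite mulrAC.
Qed.
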